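(* For any fixed graph $G$ with chromatic number at least $3$, $$2^n-\mathrm{vex}(n,G)=\Theta_G\Bigl(\binom{n}{\mathrm{emb}(n,G)}\Bigr)$$ as $n\to\infty$, i.e. there are constants $0<c_G\le C_G$ depending only on $G$ such that $c_G\binom{n}{\mathrm{emb}(n,G)}\le 2^n-\mathrm{vex}(n,G)\le C_G\binom{n}{\mathrm{emb}(n,G)}$ for all sufficiently large $n$.
   Context: The Kneser cube $\mathrm{Kn}_n$ is the graph with vertex set $2^{[n]}$ (all subsets of $[n]=\{1,\dots,n\}$) in which two distinct sets are adjacent iff they are disjoint. A family $\mathcal F\subseteq 2^{[n]}$ is $G$-free if the subgraph of $\mathrm{Kn}_n$ induced by $\mathcal F$ contains no subgraph isomorphic to $G$; $\mathrm{vex}(n,G)$ is the maximum size of a $G$-free family in $2^{[n]}$. The Kneser graph $\mathrm{Kn}(n,m)$ has vertex set $\binom{[n]}{m}$ (the $m$-subsets of $[n]$), two sets adjacent iff disjoint. $\mathrm{emb}(n,G)$ denotes the maximum $m$ such that $\mathrm{Kn}(n,m)$ contains a (not necessarily induced) subgraph isomorphic to $G$. *)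

(* Defs.v *)
From mathcomp Require Import all_boot.
Set Implicit Arguments.
Unset Strict Implicit.
Unset Printing Implicit Defensive.

Record sgraph := SGraph {
  svertex :> finType;
  sedge : rel svertex;
  sedge_sym : symmetric sedge;
  sedge_irrefl : irreflexive sedge }.

Definition colorable (G : sgraph) (k : nat) : bool :=
  [exists f : {ffun G -> 'I_k},
     [forall x : G, forall y : G, sedge x y ==> (f x != f y)]].

Lemma colorable_ex (G : sgraph) : exists k, colorable G k.
Proof.
exists #|G|; apply/existsP; exists [ffun x => enum_rank x].
apply/forallP=> x; apply/forallP=> y; apply/implyP=> xy; rewrite !ffunE.
by apply: contraTneq xy => /enum_rank_inj ->; rewrite sedge_irrefl.
Qed.

Definition chromatic_number (G : sgraph) : nat := ex_minn (colorable_ex G).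

(* H has a not necessarily induced subgraph isomorphic to G: such a copy is
   the image of an injective map that sends edges to edges. *)
Definition contains_copy (H G : sgraph) : bool :=
  [exists f : {ffun G -> H}, injectiveb f &&
     [forall x : G, forall y : G, sedge x y ==> sedge (f x) (f y)]].

Section Induced.
Variables (H : sgraph) (F : {set H}).

Definition induced_edge : rel {x : H | x \in F} :=
  [rel x y | sedge (val x) (val y)].

Lemma induced_edge_sym : symmetric induced_edge.
Proof. by move=> x y; apply: sedge_sym. Qed.

Lemma induced_edge_irrefl : irreflexive induced_edge.
Proof. by move=> x; apply: sedge_irrefl. Qed.

Definition induced : sgraph := SGraph induced_edge_sym induced_edge_irrefl.
End Induced.

(* The ground set [n] is 'I_n.  Distinctness only matters for set0, the one
   set that is disjoint from itself. *)
Definition kneser_edge (n : nat) : rel {set 'I_n} :=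
  [rel A B : {set 'I_n} | (A != B) && [disjoint A & B]].

Lemma kneser_edge_sym n : symmetric (@kneser_edge n).
Proof. by move=> A B; rewrite /kneser_edge /= eq_sym disjoint_sym. Qed.

Lemma kneser_edge_irrefl n : irreflexive (@kneser_edge n).
Proof. by move=> A; rewrite /kneser_edge /= eqxx. Qed.

Definition kneser_cube (n : nat) : sgraph :=
  SGraph (@kneser_edge_sym n) (@kneser_edge_irrefl n).

Definition kneser_graph (n m : nat) : sgraph :=
  @induced (kneser_cube n) [set A : {set 'I_n} | #|A| == m].

Definition free_family (n : nat) (G : sgraph) (F : {set {set 'I_n}}) : bool :=
  ~~ contains_copy (@induced (kneser_cube n) F) G.

(* The empty family is G-free as soon as G has a vertex. *)
Definition vex (n : nat) (G : sgraph) : nat :=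
  \max_(F : {set {set 'I_n}} | free_family G F) #|F|.

(* For m > n the graph kneser_graph n m has no vertex, so m <= n loses nothing
   when G has a vertex.  If no m qualifies the value is 0; m = 1 qualifies as
   soon as n >= #|G|, since kneser_graph n 1 is complete on n vertices. *)
Definition emb (n : nat) (G : sgraph) : nat :=
  \max_(m < n.+1 | contains_copy (kneser_graph n m) G) m.

(* Main.v *)
(* Write l = emb n G and g = #|G|. Moving a copy of G in Kn(n, l) by a uniformly
    random permutation of [n] shows that a G-free family misses at least a
    fraction 1/g of the l-sets. Conversely, the sets of size at least l+2 form a
    G-free family once l+2 >= g: in a copy of G, every set could be shrunk to one
    of its l+2 or more (l+1)-subsets, with distinct choices for distinct vertices.
    The missed sets number sum_(i <= l+1) 'C(n, i). This sum is O('C(n, l)) because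
    l >= floor(n/g) and l stays a linear amount below n/2: the two
    sets of an edge leave only n-2l points uncovered, so if g^2 (n-2l) < n then some
    point lies in exactly one of the two sets of every edge and 2-colours G. *)
Require Import Defs.
From mathcomp Require Import all_boot all_order all_algebra all_fingroup.
From mathcomp Require Import reals zify.
Import Order.TTheory GRing.Theory Num.Theory.
Set Implicit Arguments.
Unset Strict Implicit.
Unset Printing Implicit Defensive.

(** * Copies in the cube and distinct representatives *)

Lemma copy_inducedP (n : nat) (G : sgraph) (F : {set {set 'I_n}}) :
  reflect (exists2 f : G -> {set 'I_n},
             injective f /\ (forall x, f x \in F) &
             forall x y, sedge x y -> [disjoint f x & f y])
          (contains_copy (@induced (kneser_cube n) F) G).
Proof.
apply: (iffP existsP) => [[f /andP[/injectiveP f_inj /forallP f_hom]]|].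
  exists (fun x => val (f x)).
    by split=> [x y /val_inj/f_inj //|x]; apply: valP.
  move=> x y xy; have /forallP/(_ y)/implyP/(_ xy) := f_hom x.
  by case/andP.
case=> f [f_inj fF] f_hom.
exists [ffun x => Sub (f x) (fF x) : @induced (kneser_cube n) F].
apply/andP; split.
  by apply/injectiveP=> x y; rewrite !ffunE => -[/f_inj].
apply/forallP=> x; apply/forallP=> y; apply/implyP=> xy; rewrite !ffunE.
apply/andP; split; last exact: f_hom.
(* Adjacent vertices of [G] differ, so injectivity supplies the distinctness required by
   [kneser_edge]. *)
by apply: contraTneq xy => /f_inj ->; rewrite sedge_irrefl.
Qed.

(** Greedy choice: the values already used at the other indices number fewer than [#|I|], so they
    never exhaust [D i]. *)
Lemma distinct_representatives (I U : finType) (D : I -> {set U}) :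
  (forall i, #|I| <= #|D i|) ->
  exists2 f : I -> U, injective f & forall i, f i \in D i.
Proof.
move=> leID.
have [f0 f0D] : exists f : I -> U, forall i, f i \in D i.
  apply: (@fin_all_exists _ (fun=> U) (fun i u => u \in D i)) => i.
  by apply/card_gt0P/(leq_trans _ (leID i))/card_gt0P; exists i.
suff [f [fD f_inj]] : exists f : I -> U, (forall i, f i \in D i) /\
    {in enum I &, injective f}.
  by exists f => // i j; apply: f_inj; rewrite mem_enum.
elim: (enum I) (enum_uniq I) => [_|i s IHs /= /andP[i_s s_uniq]].
  by exists f0.
have [f [fD f_inj]] := IHs s_uniq.
have /subsetPn[u uD u_s] : ~~ (D i \subset [set f j | j in s]).
  apply/negP=> /subset_leq_card; apply/negP; rewrite -ltnNge.
  apply: leq_trans (leID i); apply: leq_ltn_trans (leq_imset_card _ _) _.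
  by rewrite -(cardC [in s]) -addn1 leq_add2l; apply/card_gt0P; exists i.
exists (fun j => if j == i then u else f j); split=> [j|].
  by case: eqP => // ->.
have us j : j \in s -> u != f j.
  by move=> js; apply: contraNneq u_s => ->; apply: imset_f.
move=> j k; rewrite !inE.
have [-> _|_ /= js] := eqVneq j i; have [-> _|_ /= ks] := eqVneq k i => //.
- by move=> /eqP; rewrite (negPf (us k ks)).
- by move=> /eqP; rewrite eq_sym (negPf (us j js)).
- exact: f_inj.
Qed.

Lemma leq_card_bigcup (I T : finType) (A : I -> {set T}) :
  #|\bigcup_i A i| <= \sum_i #|A i|.
Proof.
apply: (big_ind2 (fun (B : {set T}) m => #|B| <= m)) => [|B m C k leB leC|//].
  by rewrite cards0.
by apply: leq_trans (leq_card_setU B C).1 _; apply: leq_add.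
Qed.

(** * Averaging over permutations *)

Section PermFibers.
Local Open Scope group_scope.
Variable T : finType.
Implicit Types (A B : {set T}) (s : {perm T}).

(** List each set followed by its complement and match the two lists position by position; [A] and
    [B] occupy initial segments of equal length. *)
Lemma perm_imset_transitive A B : #|A| = #|B| -> exists s, s @: A = B.
Proof.
move=> eqAB; pose l (C : {set T}) := enum C ++ enum (~: C).
have mem_l C x : x \in l C by rewrite mem_cat !mem_enum inE orbN.
have size_l C : size (l C) = #|T| by rewrite size_cat -!cardE cardsC.
have uniq_l C : uniq (l C).
  rewrite cat_uniq !enum_uniq /= andbT; apply/hasPn=> x.
  by rewrite !mem_enum inE.
pose h x := nth x (l B) (index x (l A)).
have idx_lt x : index x (l A) < #|T| by rewrite -(size_l A) index_mem.
have h_inj : injective h.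
  move=> x y; rewrite /h (set_nth_default x y) ?size_l // => /eqP.
  rewrite nth_uniq ?size_l // => /eqP /(congr1 (nth x (l A))).
  by rewrite !nth_index.
exists (perm h_inj); apply/eqP; rewrite eqEcard card_imset; last exact: perm_inj.
rewrite eqAB leqnn andbT; apply/subsetP=> _ /imsetP[x xA ->].
rewrite permE /h index_cat mem_enum xA nth_cat.
have lt : index x (enum A) < size (enum B).
  by rewrite -cardE -eqAB cardE index_mem mem_enum.
by rewrite lt -mem_enum mem_nth.
Qed.

(** If [t] carries [A'] to [A] and [u] carries [B] to [B'], then [s] maps injectively to
    [t * s * u], where [t] acts first. *)
Lemma leq_card_perm_fiber A B A' B' : #|A| = #|A'| -> #|B| = #|B'| ->
  #|[set s : {perm T} | s @: A == B]| <= #|[set s : {perm T} | s @: A' == B']|.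
Proof.
move=> /esym/perm_imset_transitive[t tA] /perm_imset_transitive[u uB].
rewrite -(card_imset _ (f := fun s => t * s * u)); last first.
  by move=> s s' /= ?; apply: (mulgI t); apply: (mulIg u).
apply/subset_leq_card/subsetP=> _ /imsetP[s sA ->]; rewrite !inE in sA *; move/eqP: sA => sA.
rewrite -uB -sA -tA -!imset_comp; apply/eqP/eq_imset => x /=.
by rewrite !permM.
Qed.

Lemma card_perm_fiber A B A' B' : #|A| = #|A'| -> #|B| = #|B'| ->
  #|[set s : {perm T} | s @: A == B]| = #|[set s : {perm T} | s @: A' == B']|.
Proof.
by move=> eA eB; apply/eqP; rewrite eqn_leq !leq_card_perm_fiber.
Qed.

End PermFibers.

Lemma free_family_missing (n m : nat) (G : sgraph) (F : {set {set 'I_n}}) :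
  contains_copy (kneser_graph n m) G -> free_family G F ->
  'C(n, m) <= #|G| * #|~: F|.
Proof.
case/copy_inducedP=> f [f_inj f_card] f_hom F_free.
have [G0|/card_gt0P[v0 _]] := posnP #|G|.
  case/negP: F_free; apply/copy_inducedP; exists f; last by [].
  by split=> [//|x]; case: (fintype0 x G0).
have fm v : #|f v| = m by have := f_card v; rewrite inE => /eqP.
(* By [card_perm_fiber], [h] permutations carry any given [m]-set to any other, so counting
   permutations amounts to counting [m]-sets. *)
pose h := #|[set s : {perm 'I_n} | s @: f v0 == f v0]|.
have fiber v (B : {set _}) : #|B| = m -> #|[set s : {perm 'I_n} | s @: f v == B]| = h.
  by move=> Bm; apply: card_perm_fiber; rewrite !fm.
have count v (X : {set {set 'I_n}}) : (forall B : {set _}, B \in X -> #|B| = m) ->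
    #|[set s : {perm 'I_n} | s @: f v \in X]| = #|X| * h.
  move=> Xm; rewrite -sum_nat_const -sum1_card.
  rewrite (partition_big (fun s : {perm 'I_n} => s @: f v) [in X]) => [|s].
    apply: eq_bigr => B BX; rewrite -(fiber v B (Xm B BX)) -sum1_card.
    by apply: eq_bigl => s; rewrite !inE; case: eqP => [->|]; rewrite ?BX ?andbF.
  by rewrite inE.
have im_card (s : {perm 'I_n}) v : #|s @: f v| = m.
  by rewrite card_imset ?fm //; apply: perm_inj.
have total : #|{perm 'I_n}| = 'C(n, m) * h.
  have -> : 'C(n, m) = #|[set A : {set 'I_n} | #|A| == m]|.
    by rewrite card_draws card_ord.
  rewrite -(count v0) => [|B]; last first.
    by rewrite inE => /eqP.
  by rewrite -cardsT; apply: eq_card => s; rewrite !inE im_card eqxx.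
have h_gt0 : 0 < h.
  by apply/card_gt0P; exists 1%g; rewrite inE; apply/eqP/setP => i;
     rewrite (eq_imset (g := id)) ?imset_id // => j; rewrite perm1.
rewrite -(leq_pmul2r h_gt0) -total -mulnA.
pose X := [set B in ~: F | #|B| == m].
have X_le : #|X| <= #|~: F|.
  by apply/subset_leq_card/subsetP => B; rewrite inE => /andP[].
(* Each permutation yields another copy of [G], hence moves some [f v] out of [F]; a union bound
   over [v] follows. *)
apply: (@leq_trans (\sum_(v : G) #|[set s : {perm 'I_n} | s @: f v \in X]|)).
  apply: leq_trans (leq_card_bigcup _); rewrite -cardsT.
  apply/subset_leq_card/subsetP => s _; apply/bigcupP.
  have [v sv|allF] := pickP (fun v => s @: f v \notin F).
    by exists v => //; rewrite !inE sv im_card eqxx.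
  case/negP: F_free; apply/copy_inducedP; exists (fun v => s @: f v).
    split=> [u v /imset_inj/f_inj //|v]; last by have /negbFE := allF v.
    by move=> /(_ perm_inj).
  move=> u v uv; rewrite -setI_eq0 -imsetI => [|x y _ _ /perm_inj //].
  by rewrite (disjoint_setI0 (f_hom u v uv)) imset0.
apply: (@leq_trans (\sum_(v : G) #|~: F| * h)); last by rewrite sum_nat_const.
apply: leq_sum => v _; rewrite count ?leq_mul2r ?X_le ?orbT //.
by move=> B; rewrite inE => /andP[_ /eqP].
Qed.

(** * Set sizes that allow or exclude a copy *)

Lemma half_gap_of_copy (n m : nat) (G : sgraph) :
  ~~ colorable G 2 -> contains_copy (kneser_graph n m) G ->
  n <= #|G| ^ 2 * (n - m.*2).
Proof.
move=> G_col /copy_inducedP[f [f_inj f_card] f_hom]; rewrite leqNgt.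
apply: contra G_col => lt.
have fm v : #|f v| = m by have := f_card v; rewrite inE => /eqP.
(* Indexing by all ordered pairs, with nothing bad at a non-edge, gives the factor [#|G| ^ 2]. *)
pose bad (e : G * G) := if sedge e.1 e.2 then ~: (f e.1 :|: f e.2) else set0.
have card_bad e : #|bad e| <= n - m.*2.
  rewrite /bad; case: ifP => [e_edge|]; last by rewrite cards0.
  rewrite cardsCs setCK card_ord cardsU (disjoint_setI0 (f_hom _ _ e_edge)).
  by rewrite cards0 !fm subn0 addnn.
have /subsetPn[x _ x_bad] : ~~ ([set: 'I_n] \subset \bigcup_e bad e).
  apply/negP=> /subset_leq_card; apply/negP; rewrite -ltnNge cardsT card_ord.
  apply: leq_ltn_trans lt; apply: (@leq_trans (\sum_e #|bad e|)).
    exact: leq_card_bigcup.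
  apply: (@leq_trans (\sum_(e : G * G) (n - m.*2))); first exact: leq_sum.
  by rewrite sum_nat_const card_prod.
apply/existsP; exists [ffun v => if x \in f v then ord0 else ord_max].
apply/forallP=> u; apply/forallP=> v; apply/implyP=> uv; rewrite !ffunE.
have : x \in f u :|: f v.
  apply: contraR x_bad => xuv; apply/bigcupP; exists (u, v) => //.
  by rewrite /bad /= uv inE.
rewrite inE; have /disjoint_setI0/setP/(_ x) := f_hom u v uv.
by rewrite !inE; case: (x \in f u); case: (x \in f v).
Qed.

(** Give the vertices pairwise disjoint blocks of [m] points; being nonempty, the blocks are
    distinct. *)
Lemma copy_blocks (n m : nat) (G : sgraph) :
  0 < m -> #|G| * m <= n -> contains_copy (kneser_graph n m) G.
Proof.
move=> m_gt0 le_n.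
have le_pn : #|{: G * 'I_m}| <= n by rewrite card_prod card_ord.
pose h p : 'I_n := widen_ord le_pn (enum_rank p).
have h_inj : injective h by move=> p q /(congr1 val) /= e; apply/enum_rank_inj/val_inj.
pose B v := [set h (v, j) | j : 'I_m].
have Bm v : #|B v| = m.
  by rewrite card_imset ?card_ord // => i j /h_inj[].
have B_eq u v x : x \in B u -> x \in B v -> u = v.
  by case/imsetP=> i _ -> /imsetP[j _ /h_inj[]].
apply/copy_inducedP; exists B.
  split=> [u v eqB|v]; last by rewrite inE Bm.
  have /card_gt0P[x xu] : 0 < #|B u| by rewrite Bm.
  by apply: (B_eq u v x xu); rewrite -eqB.
move=> u v uv; rewrite -setI_eq0; apply/eqP/setP=> x; rewrite !inE.
apply: contraTF uv => /andP[xu xv].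
by rewrite (B_eq u v x xu xv) sedge_irrefl.
Qed.

Lemma large_sets_free (n m : nat) (G : sgraph) :
  #|G| <= m.+1 -> ~~ contains_copy (kneser_graph n m) G ->
  free_family G [set A : {set 'I_n} | m < #|A|].
Proof.
move=> leGm; apply: contra => /copy_inducedP[f [_ f_card] f_hom].
have := @distinct_representatives _ _
  (fun v => [set A : {set 'I_n} | A \subset f v & #|A| == m]).
case=> [v|g g_inj gP].
  rewrite cards_draws; apply: leq_trans leGm _.
  have := f_card v; rewrite inE => lt.
  (* A set of more than [m] points has at least ['C(m.+1, m) = m.+1] subsets of size [m]. *)
  by rewrite -(binSn m); apply: leq_bin2l.
apply/copy_inducedP; exists g.
  by split=> // v; have := gP v; rewrite !inE => /andP[].
move=> u v uv.
have := gP u; have := gP v; rewrite !inE => /andP[gv _] /andP[gu _].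
exact: disjointW gu gv (f_hom u v uv).
Qed.

(** * Counting small sets *)

Lemma card_set_ord (n : nat) : #|{set 'I_n}| = 2 ^ n.
Proof. by rewrite -cardsT -powersetT card_powerset cardsT card_ord. Qed.

Lemma card_small_sets (n k : nat) :
  #|[set A : {set 'I_n} | #|A| < k]| = \sum_(i < k) 'C(n, i).
Proof.
rewrite -sum1_card; under eq_bigl => A do rewrite inE.
elim: k => [|k IHk]; first by rewrite big_ord0 big_pred0.
rewrite big_ord_recr /= -IHk (bigID (fun A : {set 'I_n} => #|A| < k)) /=.
congr (_ + _); first by apply: eq_bigl => A; lia.
have -> : 'C(n, k) = #|[set A : {set 'I_n} | #|A| == k]|.
  by rewrite card_draws card_ord.
by rewrite -sum1_card; apply: eq_bigl => A; rewrite inE ltnS -leqNgt eqn_leq.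
Qed.

(** For [k < m] the ratio of ['C(n, k)] to ['C(n, k.+1)] is [(k+1)/(n-k)], at most [e/(e+1)]; the
    geometric series with that ratio sums to [e+1]. *)
Lemma sum_bin_leq (n m e : nat) : e.+1 * m <= e * (n - m) ->
  \sum_(i < m.+1) 'C(n, i) <= e.+1 * 'C(n, m).
Proof.
move=> gap.
suff IH k : k <= m -> \sum_(i < k.+1) 'C(n, i) <= e.+1 * 'C(n, k) by exact: IH.
elim: k => [_|k IHk lt_km]; first by rewrite big_ord1 bin0 muln1.
rewrite big_ord_recr /= mulSn addnC leq_add2l.
apply: leq_trans (IHk (ltnW lt_km)) _.
have bin_step := mul_bin_left n k.
rewrite -(leq_pmul2l (ltn0Sn k)) mulnCA mulnA -[leqRHS]mulnCA bin_step.
nia.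
Qed.

Lemma leq_emb (n m : nat) (G : sgraph) :
  0 < #|G| -> contains_copy (kneser_graph n m) G -> m <= emb n G.
Proof.
move=> G_gt0 copy; have m_n : m < n.+1.
  case/copy_inducedP: (copy) => f [_ f_card] _; case/card_gt0P: G_gt0 => v _.
  have := f_card v; rewrite inE => /eqP <-.
  by rewrite ltnS -[leqRHS]card_ord max_card.
by rewrite -[m]/(val (Ordinal m_n)); apply: leq_bigmax_cond.
Qed.

(** * The two bounds on [vex], stated additively because subtraction in [nat] truncates *)

Section LargeGroundSet.
Variables (n : nat) (G : sgraph).
Hypotheses (G_gt0 : 0 < #|G|) (le_n : #|G| ^ 2 <= n).

Let copy_quotient : contains_copy (kneser_graph n (n %/ #|G|)) G.
Proof.
apply: copy_blocks; last by rewrite mulnC leq_divM.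
by rewrite divn_gt0 // (leq_trans _ le_n) // -{1}[#|G|]expn1 leq_pexp2l.
Qed.

Lemma divn_leq_emb : n %/ #|G| <= emb n G.
Proof. exact: leq_emb. Qed.

(** The value [n %/ #|G|] qualifies, so the maximum is attained and is not the default 0 of an empty
    range. *)
Lemma emb_copy : contains_copy (kneser_graph n (emb n G)) G.
Proof.
have q_lt : n %/ #|G| < n.+1 by rewrite ltnS leq_div.
pose P := [pred m : 'I_n.+1 | contains_copy (kneser_graph n m) G].
have P_gt0 : 0 < #|P| by apply/card_gt0P; exists (Ordinal q_lt).
have [m mP mE] := eq_bigmax_cond (fun m : 'I_n.+1 => m : nat) P_gt0.
by rewrite /emb mE.
Qed.

Lemma vex_upper : #|G| * vex n G + 'C(n, emb n G) <= #|G| * 2 ^ n.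
Proof.
have free0 : 0 < #|[pred F : {set {set 'I_n}} | free_family G F]|.
  apply/card_gt0P; exists set0; apply/copy_inducedP=> -[f [_ f0] _].
  by case/card_gt0P: G_gt0 => v _; have := f0 v; rewrite inE.
have [F F_free vexE] := eq_bigmax_cond (fun F : {set {set 'I_n}} => #|F|) free0.
rewrite /vex vexE -card_set_ord -(cardsC F) mulnDr leq_add2l.
exact: free_family_missing emb_copy F_free.
Qed.

Lemma vex_lower : ~~ colorable G 2 ->
  2 ^ n <= vex n G + (#|G| ^ 2 + #|G|).+1 * 'C(n, emb n G).
Proof.
move=> G_col; set l := emb n G; set g := #|G|.
have g_le_l : g <= l.
  by apply: leq_trans divn_leq_emb; rewrite leq_divRL // mulnn.
have F_free : free_family G [set A : {set 'I_n} | l.+1 < #|A|].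
  apply: large_sets_free; first by rewrite !leqW.
  (* A copy in Kn(n, l+1) would contradict the maximality of [l]. *)
  by apply/negP=> /(leq_emb G_gt0); rewrite ltnn.
have leF := leq_bigmax_cond (F := fun F : {set {set 'I_n}} => #|F|) _ F_free.
have gap := half_gap_of_copy G_col emb_copy.
have small : #|~: [set A : {set 'I_n} | l.+1 < #|A|]|
    = \sum_(i < l.+2) 'C(n, i).
  by rewrite -card_small_sets; apply: eq_card => A; rewrite !inE -leqNgt.
rewrite -card_set_ord -(cardsC [set A : {set 'I_n} | l.+1 < #|A|]) leq_add //.
(* The layers up to [l] cost [g^2 + 1] times ['C(n, l)], by [sum_bin_leq] with [e = g^2]; layer
   [l+1] costs another [g], since [n <= g * l.+1]. *)
rewrite small big_ord_recr /= -addSn mulnDl leq_add //.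
  apply: sum_bin_leq; rewrite -/l -/g in gap *.
  nia.
have n_le : n <= g * l.+1.
  have := ltn_ceil n G_gt0; rewrite -/g => /ltnW/leq_trans; apply.
  by rewrite mulnC leq_mul2l ltnS divn_leq_emb orbT.
have bin_step := mul_bin_left n l.
rewrite -(leq_pmul2l (ltn0Sn l)) bin_step mulnA leq_mul2r; apply/orP; right.
by rewrite mulnC (leq_trans _ n_le) // leq_subr.
Qed.

End LargeGroundSet.

Local Open Scope ring_scope.

Theorem theorem1p4 (R : realType) (G : sgraph)
    (hG : (3 <= chromatic_number G)%N) :
  exists c C : R, [/\ 0 < c, c <= C &
    exists N : nat, forall n : nat, (N <= n)%N ->
      c * 'C(n, emb n G)%:R <= 2 ^+ n - (vex n G)%:R
      /\ 2 ^+ n - (vex n G)%:R <= C * 'C(n, emb n G)%:R].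
Proof.
have G_col : ~~ colorable G 2.
  apply: contraL hG => G2; rewrite -ltnNge ltnS /chromatic_number.
  by case: ex_minnP => k _; apply.
have G_gt0 : (0 < #|G|)%N.
  rewrite lt0n; apply: contra G_col => /eqP G0.
  by apply/existsP; exists [ffun=> ord0]; apply/forallP=> x;
     case: (fintype0 x G0).
exists #|G|%:R^-1, (#|G| ^ 2 + #|G|).+1%:R.
have g_gt0 : 0 < #|G|%:R :> R by rewrite ltr0n.
split; first by rewrite invr_gt0.
  by apply: (@le_trans _ _ 1); rewrite ?invf_le1 ?ler1n.
(* From [#|G| ^ 2] on, [n %/ #|G|] is at least [#|G|], hence so is [emb n G], as the choice of
   distinct subsets requires. *)
exists (#|G| ^ 2)%N => n le_n; split.
  rewrite mulrC ler_pdivrMr // mulrBl lerBrDr -natrX -!natrM -natrD ler_nat.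
  by rewrite addnC ![(_ * #|G|)%N]mulnC vex_upper.
by rewrite lerBlDl -natrX -natrM -natrD ler_nat vex_lower.
Qed.
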